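(* Let $\{G_p\}_{p\in P}$ be a one-parametric family of regions that is monotone, i.e. $G_{p_1}\subset G_{p_2}$ whenever $p_1<p_2$ ($p_1,p_2\in P$), and thick, i.e. every point $y\in D$ belongs to the boundary of a unique set of the family (the parameter of that set being denoted $q(y)\in P$, so that $y\in\partial G_{q(y)}$). Let $V(p;x)=\mathbf{E}^x\, g(X_{\tau_p})e^{-\rho\tau_p}\mathbf{1}_{\{\tau_p<\infty\}}$ with $\tau_p=\inf\{t\ge 0: X_t\notin G_p\}$, and fix an initial state $x\in D$. Consider the problem of maximizing $V(p;x)$ over $p\in P$. (i) If $p^*=p^*(x)\in P$ is a solution of this problem, i.e. $V(p^*;x)=\sup_{p\in P}V(p;x)$, then the following two conditions hold: $$V(p;x)\le V(p^*;x)\quad\text{whenever } p<p^*,\ x\in G_p\cup\partial G_p,$$ $$V(p;x)\le g(x)\quad\text{whenever } p>p^*,\ x\in G_p\setminus G_{p^*}.$$ (ii) If for some $p^*=p^*(x)\in P$ one has $$V(p;x)\le V(p^*;x)\quad\text{whenever } p<p^*,\ x\in G_p\cup\partial G_p,$$ and $$V(p_1;x)\ge V(p_2;x)\quad\text{whenever } p^*\le p_1<p_2,\ x\in G_{p_2},$$ (here $p,p_1,p_2$ range over $P$), then $p^*$ is a solution of the problem, i.e. $V(p^*;x)=\sup_{p\in P}V(p;x)$.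
   Context: $X_t$, $t\ge 0$, is a diffusion process with values in $D\subseteq\mathbb{R}^n$; $\mathbf{E}^x$ denotes expectation for the process started at $X_0=x$; $g:D\to\mathbb{R}$ is a payoff function and $\rho>0$ a discount rate. $P\subset\mathbb{R}$, and $\{G_p,\ p\in P\}$ is a family of regions (open sets) in $\mathbb{R}^n$, with boundary $\partial G_p$. Put $\tau_p=\inf\{t\ge 0: X_t\notin G_p\}$ and $$V(p;x)=\mathbf{E}^x\, g(X_{\tau_p})e^{-\rho\tau_p}\mathbf{1}_{\{\tau_p<\infty\}},\qquad p\in P,\ x\in D$$ (these expectations are assumed well defined). In particular $V(p;x)=g(x)$ for $x\notin G_p$. Assumptions on the family: Monotonicity: $G_{p_1}\subset G_{p_2}$ whenever $p_1<p_2$. Thickness: every point $x\in D$ belongs to the boundary of a unique set of the family; the parameter of that set is denoted $q(x)\in P$, so $x\in\partial G_{q(x)}$. *)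

(* Defs.v *)
From HB Require Import structures.
From mathcomp Require Import all_boot all_order all_algebra.
From mathcomp Require Import all_classical all_reals all_analysis.
From mathcomp Require Import measurable_realfun.

Set Implicit Arguments.
Unset Strict Implicit.
Unset Printing Implicit Defensive.

Import Order.TTheory GRing.Theory Num.Theory.
Import numFieldNormedType.Exports.

Local Open Scope classical_set_scope.
Local Open Scope ring_scope.

(** R^n is ['rV[R]_n].  Maps defined on a state space [D] (the laws [Pr x], the
    payoff [g]) are total on ['rV[R]_n]; their values outside [D] are never used. *)

Definition boundary (T : topologicalType) (A : set T) : set T :=
  closure A `\` interior A.

Definition borel (T : topologicalType) : set (set T) :=
  <<s [set U : set T | open U] >>.

(** Measurability with respect to the trace on [D] of the Borel sets.  [D] need
    not be Borel itself, in which case [measurable_fun D f] would be vacuous. *)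
Definition trace_measurable (R : realType) (T : topologicalType) (D : set T)
    (f : T -> \bar R) : Prop :=
  forall Y : set (\bar R), measurable Y ->
    exists2 B : set T, borel B & D `&` f @^-1` Y = D `&` B.

Section processes.
Context {R : realType} {n : nat} {d : measure_display}
  {Omega : measurableType d}.

Definition filtration (F : R -> set (set Omega)) : Prop :=
  [/\ forall t, 0 <= t -> sigma_algebra setT (F t),
      forall s t, 0 <= s -> s <= t -> F s `<=` F t
    & forall t, 0 <= t -> F t `<=` measurable].

Definition stopping_time (F : R -> set (set Omega)) (T : Omega -> \bar R) :
    Prop :=
  (forall w, 0%E <= T w)%E /\
  (forall t, 0 <= t -> F t [set w | (T w <= t%:E)%E]).

(** The sigma-algebra of the events prior to [T]. *)
Definition prior (F : R -> set (set Omega)) (T : Omega -> \bar R) :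
    set (set Omega) :=
  [set A | measurable A /\
           forall t, 0 <= t -> F t (A `&` [set w | (T w <= t%:E)%E])].

(** A diffusion is a conservative strong Markov process with continuous paths in
    [D]; [Pr x] is the law of the process started at [x], and only times [t >= 0]
    are meaningful.  In the strong Markov property the conditional-expectation
    identity [Pr x (X_(T + t) \in B | F_T) = Pr X_T (X_t \in B)] on [T < oo] is
    written in integrated form over the events [A] prior to [T]. *)
Record diffusion (D : set 'rV[R]_n) (F : R -> set (set Omega))
    (Pr : 'rV[R]_n -> probability Omega R) (X : R -> Omega -> 'rV[R]_n) :
    Prop := Diffusion {
  diffusion_filtration : filtration F ;
  diffusion_state : forall t w, 0 <= t -> D (X t w) ;
  diffusion_adapted : forall t B, 0 <= t -> borel B -> F t (X t @^-1` B) ;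
  diffusion_continuous : forall w,
    {within [set t : R | 0 <= t], continuous (fun t => X t w)} ;
  diffusion_start : forall x, D x -> Pr x [set w | X 0 w = x] = 1%E ;
  diffusion_measurable : forall t B, 0 <= t -> borel B ->
    trace_measurable D (fun y => Pr y (X t @^-1` B)) ;
  diffusion_strong_markov : forall x T A t B,
    D x -> stopping_time F T -> prior F T A -> 0 <= t -> borel B ->
    Pr x (A `&` [set w | (T w < +oo)%E /\ B (X (fine (T w) + t) w)]) =
    (\int[Pr x]_(w in A `&` [set w | T w < +oo])
       Pr (X (fine (T w)) w) (X t @^-1` B))%E
}.

(** The infimum of the empty set is [+oo]. *)
Definition exit_time (X : R -> Omega -> 'rV[R]_n) (G : set 'rV[R]_n)
    (w : Omega) : \bar R :=
  ereal_inf [set t%:E | t in [set t : R | 0 <= t /\ ~ G (X t w)]].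

Definition exit_payoff (X : R -> Omega -> 'rV[R]_n) (g : 'rV[R]_n -> R)
    (rho : R) (G : set 'rV[R]_n) (w : Omega) : R :=
  let tau := exit_time X G w in
  if (tau < +oo)%E then g (X (fine tau) w) * expR (- rho * fine tau) else 0.

Definition value (Pr : 'rV[R]_n -> probability Omega R)
    (X : R -> Omega -> 'rV[R]_n) (g : 'rV[R]_n -> R) (rho : R)
    (G : R -> set 'rV[R]_n) (p : R) (x : 'rV[R]_n) : \bar R :=
  (\int[Pr x]_w (exit_payoff X g rho (G p) w)%:E)%E.

End processes.

(** The expectation of [Y] exists in the extended reals. *)
Definition well_defined_expectation (R : realType) (d : measure_display)
    (Omega : measurableType d) (Pr : probability Omega R) (Y : Omega -> R) :
    Prop :=
  measurable_fun setT Y /\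
  ((\int[Pr]_w ((Y^\+ w)%:E) < +oo)%E \/ (\int[Pr]_w ((Y^\- w)%:E) < +oo)%E).

Definition monotone_family (R : realType) (n : nat) (P : set R)
    (G : R -> set 'rV[R]_n) : Prop :=
  forall p1 p2, P p1 -> P p2 -> p1 < p2 -> G p1 `<=` G p2.

(** [q y] is the parameter of the unique set of the family whose boundary
    contains [y]. *)
Definition thick_family (R : realType) (n : nat) (D : set 'rV[R]_n) (P : set R)
    (G : R -> set 'rV[R]_n) (q : 'rV[R]_n -> R) : Prop :=
  forall y, D y ->
    [/\ P (q y), boundary (G (q y)) y
      & forall p, P p -> boundary (G p) y -> p = q y].

Definition is_solution (R : realType) (P : set R) (V : R -> \bar R) (ps : R) :
    Prop :=
  P ps /\ V ps = ereal_sup [set V p | p in P].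

(* Main.v *)
(** The process exits [G p] at time 0 when started outside it, so [V p x = g x]
    there.  Openness and monotonicity force [q x < ps] whenever [x] lies in
    [G ps]; since [x] is not in the open set [G (q x)], the value [g x] is then
    attained at the parameter [q x], which the first condition of (ii) compares
    with [ps]. *)

Require Import Defs.
From HB Require Import structures.
From mathcomp Require Import all_boot all_order all_algebra.
From mathcomp Require Import all_classical all_reals all_analysis.
From mathcomp Require Import measurable_realfun.

Set Implicit Arguments.
Unset Strict Implicit.
Unset Printing Implicit Defensive.

Import Order.TTheory GRing.Theory Num.Theory.
Import numFieldNormedType.Exports.

Local Open Scope classical_set_scope.
Local Open Scope ring_scope.

Lemma exit_time_start (R : realType) (n : nat) (d : measure_display)
    (Omega : measurableType d) (X : R -> Omega -> 'rV[R]_n) (G : set 'rV[R]_n)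
    (w : Omega) :
  ~ G (X 0 w) -> exit_time X G w = 0%E.
Proof.
move=> nG; apply/eqP; rewrite eq_le; apply/andP; split.
  by apply: ereal_inf_lbound; exists 0.
by apply: le_ereal_inf_tmp => _ [t [t0 _] <-]; rewrite lee_fin.
Qed.

(** The process starts at [x] only almost surely, so the exceptional set must be an event before it
    can be discarded. The singleton of [x] is closed, hence Borel, because row vectors form a
    Hausdorff space. *)
Lemma measurable_start (R : realType) (n : nat) (D : set 'rV[R]_n)
    (d : measure_display) (Omega : measurableType d)
    (F : R -> set (set Omega)) (Pr : 'rV[R]_n -> probability Omega R)
    (X : R -> Omega -> 'rV[R]_n) (x : 'rV[R]_n) :
  diffusion D F Pr X -> measurable [set w | X 0 w = x].
Proof.
move=> hX; have [_ _ F_meas] := diffusion_filtration hX.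
apply: (F_meas 0 (lexx _)); apply: (diffusion_adapted hX (B := [set x])) => //.
rewrite -[[set x]]setCK -setTD; apply: sigma_algebraCD; apply: sub_sigma_algebra.
apply: closed_openC; apply: accessible_closed_set1; apply: hausdorff_accessible.
exact: norm_hausdorff.
Qed.

(** Off the null event where [X 0] differs from [x], the exit time is 0 and the discount factor is
    1, so the payoff is almost surely constant and integrates to that constant against a
    probability. *)
Lemma value_notin (R : realType) (n : nat) (D : set 'rV[R]_n)
    (d : measure_display) (Omega : measurableType d)
    (F : R -> set (set Omega)) (Pr : 'rV[R]_n -> probability Omega R)
    (X : R -> Omega -> 'rV[R]_n) (g : 'rV[R]_n -> R) (rho : R)
    (G : R -> set 'rV[R]_n) (p : R) (x : 'rV[R]_n) :
  diffusion D F Pr X -> D x ->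
  measurable_fun setT (exit_payoff X g rho (G p)) ->
  ~ G p x -> value Pr X g rho G p x = (g x)%:E.
Proof.
move=> hX hx mY nGx; have mx := measurable_start x hX.
rewrite /value (ae_eq_integral (cst (g x)%:E)) //.
- by rewrite integral_cst //= probability_setT mule1.
- exact/measurable_EFinP.
exists (~` [set w | X 0 w = x]); split; first exact: measurableC.
  by rewrite [LHS]probability_setC // (diffusion_start hX hx) subee.
move=> w /= + Xw; apply=> _.
by rewrite /exit_payoff exit_time_start Xw //= ltry mulr0 expR0 mulr1.
Qed.

Theorem theorem1 (R : realType) (n : nat) (D : set 'rV[R]_n)
    (d : measure_display) (Omega : measurableType d)
    (F : R -> set (set Omega)) (Pr : 'rV[R]_n -> probability Omega R)
    (X : R -> Omega -> 'rV[R]_n) (hX : diffusion D F Pr X)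
    (g : 'rV[R]_n -> R) (rho : R) (hrho : 0 < rho)
    (P : set R) (G : R -> set 'rV[R]_n) (q : 'rV[R]_n -> R)
    (hG : forall p, P p -> open (G p))
    (hmono : monotone_family P G)
    (hthick : thick_family D P G q)
    (hV : forall p y, P p -> D y ->
      well_defined_expectation (Pr y) (exit_payoff X g rho (G p)))
    (x : 'rV[R]_n) (hx : D x) :
  let V := value Pr X g rho G in
  (forall ps : R, is_solution P (V^~ x) ps ->
     (forall p, P p -> p < ps -> (G p `|` boundary (G p)) x ->
        (V p x <= V ps x)%E) /\
     (forall p, P p -> ps < p -> (G p `\` G ps) x ->
        (V p x <= (g x)%:E)%E)) /\
  (forall ps : R, P ps ->
     (forall p, P p -> p < ps -> (G p `|` boundary (G p)) x ->
        (V p x <= V ps x)%E) ->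
     (forall p1 p2, P p1 -> P p2 -> ps <= p1 -> p1 < p2 -> G p2 x ->
        (V p2 x <= V p1 x)%E) ->
     is_solution P (V^~ x) ps).
Proof.
move=> V.
have V_notin p : P p -> ~ G p x -> V p x = (g x)%:E.
  by move=> Pp; apply: (value_notin hX hx); have [] := hV p x Pp hx.
split=> [ps [Pps Vps]|ps Pps below above].
  have V_le p : P p -> (V p x <= V ps x)%E.
    by move=> Pp; rewrite Vps; apply: ereal_sup_ubound; exists p.
  split=> [p Pp _ _|p Pp _ [_ nGx]]; first exact: V_le.
  (* As [x] lies outside [G ps], the optimal value is itself [g x]. *)
  by rewrite -(V_notin ps) //; exact: V_le.
have [Pq bdq _] := hthick x hx.
have nGq : ~ G (q x) x.
  by move=> Gx; case: bdq => _; apply; move: (hG _ Pq) => /interior_id ->.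
have g_le : G ps x -> ((g x)%:E <= V ps x)%E.
  move=> Gx; rewrite -(V_notin (q x)) //; apply: below => //; last by right.
  (* If [ps < q x], monotonicity would put [x] in [G (q x)]; equality would do so directly. *)
  case: (ltgtP (q x) ps) => // [lt_ps|eq_ps]; last by rewrite eq_ps in nGq.
  by case: nGq; exact: hmono lt_ps _ Gx.
split=> //; apply/eqP; rewrite eq_le; apply/andP; split.
  by apply: ereal_sup_ubound; exists ps.
apply: ge_ereal_sup => _ [p Pp <-].
(* When [x] lies in [G p], the two hypotheses compare [p] with [ps] directly, the second one at
   [p1 = ps]. Otherwise [V p x] is [g x], which [g_le] bounds if [x] lies in [G ps] and which equals
   [V ps x] if not. *)
have [Gx|nGx] := pselect (G p x).
  case: (ltgtP p ps) => [lt_p|lt_ps|-> //]; first by apply: below => //; left.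
  exact: above.
rewrite V_notin //; have [/g_le //|nGps] := pselect (G ps x).
by rewrite V_notin.
Qed.
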